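(* Let $p'_1,p_2',p_3',p'_4$ be points such that, for each $i$, $p'_i$ lies in the same facet of $\Delta$ as $p_i$, and let $\Lambda'$ be the affine lattice spanned by $p'_1,\dots,p'_4$. If $\operatorname{dist}_\Delta(p_i,p'_i)\le 0.01307$ for every $i\in\{1,2,3,4\}$, then $$\operatorname{width}_{\Lambda'}(\Delta)\le\operatorname{width}_{\Lambda}(\Delta),$$ with equality if and only if $(p'_1,\dots,p'_4)=(p_1,\dots,p_4)$.
   Context: $\Delta=\operatorname{conv}(a_1,a_2,a_3,a_4)\subset\mathbb{R}^3$ with $a_1=(2+\sqrt2,\ \sqrt2,\ 2+\sqrt2)$, $a_2=(-\sqrt2,\ 2+\sqrt2,\ -2-\sqrt2)$, $a_3=(-2-\sqrt2,\ -\sqrt2,\ 2+\sqrt2)$, $a_4=(\sqrt2,\ -2-\sqrt2,\ -2-\sqrt2)$. $p_1=(-1,-1,-1)$, $p_2=(1,-1,1)$, $p_3=(1,1,-1)$, $p_4=(-1,1,1)$. For each $i$, the point $p_i$ lies in the relative interior of the facet of $\Delta$ opposite to $a_i$ (the facet spanned by the $a_j$, $j\ne i$). The points $p_1,\dots,p_4$ form an affine lattice basis of $\Lambda=\{(a,b,c): a,b,c\in 1+2\mathbb{Z},\ a+b+c\in 1+4\mathbb{Z}\}$. The affine lattice spanned by four points is the set of their integer affine combinations (integer coefficients summing to $1$). For an affine lattice $\Lambda'$, $\vec\Lambda'=\Lambda'-\Lambda'$ is the associated linear lattice and $(\vec\Lambda')^*$ its dual lattice (linear functionals taking integer values on $\vec\Lambda'$).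 For a convex body $K$ and a linear functional $f$, $\operatorname{width}(K,f)$ is the length of the segment $f(K)$, and $\operatorname{width}_{\Lambda'}(K)$ is the minimum of $\operatorname{width}(K,f)$ over all nonzero $f\in(\vec\Lambda')^*$. $\operatorname{dist}_\Delta(p,p')$ denotes the $L_\infty$ distance between the vectors of barycentric coordinates of $p$ and $p'$ with respect to the vertices of $\Delta$. *)

(* Defs.v *)
From HB Require Import structures.
From mathcomp Require Import all_boot all_order all_algebra.
From mathcomp Require Import all_classical all_reals all_analysis.
From mathcomp Require Import zify.

Set Implicit Arguments.
Unset Strict Implicit.
Unset Printing Implicit Defensive.

Import Order.TTheory GRing.Theory Num.Theory.
Import numFieldNormedType.Exports.

Local Open Scope classical_set_scope.
Local Open Scope ring_scope.

Section general.
Context {R : realType} {E : lmodType R}.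

Definition conv_hull (A : set E) : set E := smallest (@convex_set R E) A.

Definition aff_lattice n (q : 'I_n -> E) : set E :=
  [set x | exists c : 'I_n -> int,
     \sum_i c i = 1 /\ x = \sum_i (c i)%:~R *: q i].

Definition lin_lattice (L : set E) : set E := [set x - y | x in L & y in L].

Definition dual_lattice (L : set E) : set {scalar E} :=
  [set f | forall v, lin_lattice L v -> f v \is a Num.int].

Definition width (K : set E) (f : {scalar E}) : R :=
  sup (f @` K) - inf (f @` K).

Definition widths (L K : set E) : set R :=
  [set width K f | f in [set f | dual_lattice L f /\ exists x, f x != 0]].

(* This infimum is a minimum: see lattice_width_attained below. *)
Definition lattice_width (L K : set E) : R := inf (widths L K).

(* Meaningful when a is an affine basis of E, in which case there is exactly
   one such row vector l. *)
Definition bary n (a : 'I_n -> E) (x : E) : 'rV[R]_n :=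
  xget 0 [set l : 'rV[R]_n |
    \sum_i l 0 i = 1 /\ \sum_i l 0 i *: a i = x].

End general.

Section tetrahedron.
Context {R : realType}.

Local Notation V := 'rV[R]_3.
Local Notation s2 := (Num.sqrt 2 : R).

Definition vec3 (x y z : R) : V := \row_j [:: x; y; z]`_j.

Definition vert (i : 'I_4) : V :=
  [:: vec3 (2 + s2) s2 (2 + s2);
      vec3 (- s2) (2 + s2) (- 2 - s2);
      vec3 (- 2 - s2) (- s2) (2 + s2);
      vec3 s2 (- 2 - s2) (- 2 - s2)]`_i.

Definition Delta : set V := conv_hull (range vert).

Definition facet (i : 'I_4) : set V := conv_hull (vert @` [set j | j != i]).

Definition pt (i : 'I_4) : V :=
  [:: vec3 (- 1) (- 1) (- 1);
      vec3 1 (- 1) 1;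
      vec3 1 1 (- 1);
      vec3 (- 1) 1 1]`_i.

Definition Lambda : set V :=
  [set x | (forall j, exists k : int, x 0 j = (1 + 2 * k)%:~R) /\
           exists m : int, \sum_j x 0 j = (1 + 4 * m)%:~R].

(* The norm of a matrix is the maximum of the absolute values of its entries. *)
Definition dist_Delta (x y : V) : R := `| bary vert x - bary vert y |.

End tetrahedron.

Section minimum.
Context {R : realType} {n : nat}.
Local Notation V := 'rV[R]_n.+1.
Implicit Types (K : set V) (f : {scalar V}) (q : 'I_n.+2 -> V).

Lemma image_bounded K f :
  bounded_set K -> exists B, forall x, K x -> `|f x| <= B.
Proof.
move=> [M [Mreal Kb]]; pose m := Num.max 0 M + 1.
have Km x : K x -> `|x| <= m.
  by apply: Kb; rewrite /m ltr_pwDr// le_max lexx orbT.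
exists (\sum_j m * `|f (delta_mx 0 j)|) => x Kx.
rewrite (row_sum_delta x) linear_sum (le_trans (ler_norm_sum _ _ _))//.
apply: ler_sum => j _; rewrite linearZ normrM ler_wpM2r//=.
rewrite (le_trans _ (Km _ Kx))//.
by rewrite [leRHS]/Num.norm /= mx_normrE; apply/bigmax_geP; right; exists (0, j).
Qed.

Lemma width_ge K f x y :
  bounded_set K -> K x -> K y -> `|f x - f y| <= width K f.
Proof.
move=> Kb Kx Ky; have [B fB] := image_bounded f Kb.
have le_sup z : K z -> f z <= sup (f @` K).
  move=> Kz; apply: ub_le_sup; last by exists z.
  by exists B => _ [u Ku <-]; rewrite (le_trans (ler_norm _)) ?fB.
have inf_le z : K z -> inf (f @` K) <= f z.
  move=> Kz; apply: ge_inf; last by exists z.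
  by exists (- B) => _ [u Ku <-]; rewrite lerNl (le_trans (ler_norm _))// normrN fB.
by rewrite /width ler_norml opprB !lerB ?le_sup ?inf_le.
Qed.

(* For a convex body K and an affinely independent family q, the infimum in
   the definition of the lattice width is a minimum. *)
Lemma lattice_width_attained q K :
    row_free (\matrix_i (q (lift ord0 i) - q ord0)) ->
    bounded_set K -> K^° !=set0 ->
  widths (aff_lattice q) K (lattice_width (aff_lattice q) K) /\
  lbound (widths (aff_lattice q) K) (lattice_width (aff_lattice q) K).
Proof.
set M := (X in row_free X); rewrite row_free_unit => Mu Kb [x0 Kx0].
set L := aff_lattice q.
have qL i : L (q i).
  exists (fun j => (j == i)%:R); split.
    by rewrite (bigD1 i)//= eqxx big1 ?addr0// => j /negPf ->.
  rewrite (bigD1 i)//= eqxx scale1r big1 ?addr0// => j /negPf ->.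
  by rewrite scale0r.
have rowM i : row i M = q (lift ord0 i) - q ord0 by rewrite rowK.
have fE f v : f v = \sum_i (v *m invmx M) 0 i * f (row i M).
  rewrite -{1}(mulmxKV Mu v) mulmx_sum_row linear_sum; apply: eq_bigr => i _.
  by rewrite linearZ.
have [e e0 Ke] : exists2 e : R, 0 < e & ball x0 e `<=` K.
  by move/nbhs_ballP : Kx0 => [e /= e0 ?]; exists e.
pose s := 1 + \sum_i `|row i M|.
have s0 : 0 < s by rewrite /s ltr_pwDl// sumr_ge0.
pose t := e / (2 * s).
have t0 : 0 < t by rewrite divr_gt0// mulr_gt0.
have ball_in i : K (x0 + t *: row i M).
  apply: Ke; rewrite -ball_normE /= opprD addNKr normrN normrZ gtr0_norm//.
  have : `|row i M| <= s.
    by rewrite /s (bigD1 i)//= addrCA lerDl addr_ge0// sumr_ge0.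
  move=> /(ler_wpM2l (ltW t0)) /le_lt_trans; apply.
  by rewrite /t invfM mulrA mulfVK ?gt_eqF// ltr_pdivrMr// ltr_pMr// ltr1n.
have Kx : K x0 by apply: Ke; exact: ballxx.
have wbound f i : `|f (row i M)| <= width K f / t.
  rewrite ler_pdivlMr// -[t in leLHS]gtr0_norm// -normrM.
  have := width_ge f Kb (ball_in i) Kx.
  by rewrite linearD linearZ /= addrAC subrr add0r mulrC.
pose w0 (f : V -> R) := sup (f @` K) - inf (f @` K).
have [C WC] : exists C, widths L K C.
  pose f0' (v : V) : R^o := (v *m invmx M) 0 0.
  have f0lin : scalar f0'.
    by move=> a u v; rewrite /f0' mulmxDl -scalemxAl !mxE.
  pose f0m := GRing.isLinear.Build R V R^o *%R f0' f0lin.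
  pose f0 : {scalar V} := HB.pack f0' f0m.
  have f0row i : f0 (row i M) = (i == 0)%:R.
    by rewrite /f0 /= /f0' -row_mul mulmxV// !mxE.
  exists (width K f0), f0 => //; split; last first.
    by exists (row 0 M); rewrite f0row oner_neq0.
  have f0q i : f0 (q i) - f0 (q ord0) \is a Num.int.
    case: (unliftP ord0 i) => [j ->|->]; last by rewrite subrr.
    by rewrite -linearB -rowM f0row.
  have f0L x : L x -> f0 x - f0 (q ord0) \is a Num.int.
    move=> [c [c1 ->]]; rewrite linear_sum.
    have -> : f0 (q ord0) = \sum_i (c i)%:~R * f0 (q ord0).
      by rewrite -mulr_suml -[X in X * _](raddf_sum (intmul 1)) c1 mul1r.
    rewrite -sumrB rpred_sum// => i _.
    by rewrite linearZ /= -mulrBr rpredM// rpred_int.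
  move=> _ [x Lx [y Ly <-]]; rewrite linearB.
  by rewrite -[X in X \is a _](subrKA (f0 (q ord0))) rpredD ?f0L// -opprB rpredN f0L.
pose B := Num.bound `|C / t|.
pose fz (z : {ffun 'I_n.+1 -> 'I_(2 * B).+1}) (v : V) : R :=
  \sum_i (v *m invmx M) 0 i * ((z i)%:R - B%:R).
pose P z := `[< widths L K (w0 (fz z)) >].
have codeP w : widths L K w -> w <= C -> exists2 z, P z & w = w0 (fz z).
  move=> Ww wC; case: (Ww) => f [Lf _] wE.
  have fint i : exists z : 'I_(2 * B).+1, f (row i M) = z%:R - B%:R.
    have /intrP[m fm] : f (row i M) \is a Num.int.
      by apply: Lf; exists (q (lift ord0 i)) => //; exists (q ord0).
    have : `|f (row i M)| <= B%:R.
      rewrite (le_trans (wbound f i))// wE (le_trans _ (ltW (archi_boundP _)))//.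
      by rewrite (le_trans _ (ler_norm _))// ler_pM2r ?invr_gt0.
    rewrite fm -intr_norm -[B%:R]/(B%:Z%:~R) ler_int => mB.
    exists (inord (absz (m + B%:Z))); rewrite inordK; last by lia.
    by rewrite -[X in X - _]/((absz (m + B%:Z))%:Z%:~R) -intrB; congr (_%:~R); lia.
  have [z fz_] := choice fint.
  have fzE : f = fz (finfun z) :> (V -> R).
    by apply/funext => v; rewrite fE; apply: eq_bigr => i _; rewrite ffunE fz_.
  have wz : w = w0 (fz (finfun z)) by rewrite -fzE -wE.
  by exists (finfun z) => //; apply/asboolP; rewrite -wz.
have [zC PC CE] := codeP C WC (lexx _).
have [z /asboolP Wz zmin] := arg_minP (fun z => w0 (fz z)) PC.
have lb : lbound (widths L K) (w0 (fz z)).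
  move=> w Ww; have [/(codeP w Ww)[y Py ->]|/ltW] := leP w C; first exact: zmin.
  by apply: le_trans; rewrite CE zmin.
suff -> : lattice_width L K = w0 (fz z) by [].
apply/eqP; rewrite eq_le; apply/andP; split.
  by apply: ge_inf => //; exists (w0 (fz z)).
by apply: lb_le_inf => //; exists (w0 (fz z)).
Qed.

End minimum.

Lemma Lambda_spanned {R : realType} : @Lambda R = aff_lattice pt.
Proof.
have E m (k : nat) (i : 'I_m.+1) : k = i :> nat -> inord k = i by move=> ->; rewrite inord_val.
have ptE (c : 'I_4 -> int) j : (\sum_i (c i)%:~R *: @pt R i) 0 j =
    ([:: - c (inord 0) + c (inord 1) + c (inord 2) - c (inord 3);
         - c (inord 0) - c (inord 1) + c (inord 2) + c (inord 3);
         - c (inord 0) + c (inord 1) - c (inord 2) + c (inord 3)]`_j)%:~R.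
  rewrite summxE !big_ord_recl big_ord0 !mxE.
  rewrite (E _ 0%N ord0)// (E _ 1%N (lift ord0 ord0))//.
  rewrite (E _ 2%N (lift ord0 (lift ord0 ord0)))//.
  rewrite (E _ 3%N (lift ord0 (lift ord0 (lift ord0 ord0))))//.
  by case: j => [[|[|[|//]]] ?] /=; rewrite ?(mulrN1, mulr1) addr0 ?addrA ?(intrD, mulrNz).
have sum4 (c : 'I_4 -> int) : \sum_i c i =
    c (inord 0) + c (inord 1) + c (inord 2) + c (inord 3).
  rewrite !big_ord_recl big_ord0 addr0 !addrA.
  rewrite (E _ 0%N ord0)// (E _ 1%N (lift ord0 ord0))//.
  rewrite (E _ 2%N (lift ord0 (lift ord0 ord0)))//.
  by rewrite (E _ 3%N (lift ord0 (lift ord0 (lift ord0 ord0)))).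
have sum3 (x : 'I_3 -> R) : \sum_j x j = x (inord 0) + x (inord 1) + x (inord 2).
  rewrite !big_ord_recl big_ord0 addr0 !addrA.
  rewrite (E _ 0%N ord0)// (E _ 1%N (lift ord0 ord0))//.
  by rewrite (E _ 2%N (lift ord0 (lift ord0 ord0))).
apply/seteqP; split=> [x [xodd [m xsum]]|x [c [c1 ->]]].
  have [k xk] := choice xodd.
  rewrite sum3 !xk -!intrD in xsum; move/intr_inj: xsum => xsum.
  pose d := [:: 1 - 3 * m + k (inord 0) + k (inord 1) + k (inord 2);
    m - k (inord 1); m - k (inord 2); m - k (inord 0)].
  exists (fun i => d`_i); split; first by rewrite sum4 !inordK//=; lia.
  apply/rowP => j; rewrite ptE xk; congr (_%:~R); rewrite !inordK//=.
  rewrite -[j in k j]inord_val.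
  by case: j => [[|[|[|//]]] ?] /=; lia.
rewrite sum4 in c1; split=> [j|].
  by case: j => [[|[|[|//]]] ?]; rewrite ptE /=;
    [exists (c (inord 1) + c (inord 2) - 1)
    |exists (c (inord 2) + c (inord 3) - 1)
    |exists (c (inord 1) + c (inord 3) - 1)]; congr (_%:~R); lia.
exists (c (inord 1) + c (inord 2) + c (inord 3) - 1).
by rewrite sum3 !ptE -!intrD; congr (_%:~R); rewrite !inordK//=; lia.
Qed.

(* Main.v *)
Require Import Defs.
From HB Require Import structures.
From mathcomp Require Import all_boot all_order all_algebra.
From mathcomp Require Import all_classical all_reals all_analysis.
From mathcomp Require Import ring lra zify.

(** Let [P] be the matrix whose rows are the barycentric coordinates of the
    points [pt i] with respect to the vertices of [Delta], and [X] the same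
    matrix for the points [p' i].  Both have zero diagonal and row sums 1.  An
    affine functional with values [N] at the points [p' i] has values
    [X^-1 N] at the vertices, so the width of a lattice functional with a
    prescribed integer vector [N] is a maximum of linear functions of [X^-1].

    Six vectors [N] are enough: the indicators of the four singletons and of
    two pairs of consecutive indices.  For [X = P] each of them has width
    [2 + sqrt 2], attained at one pair of vertices only, and every other pair
    is shorter by at least 1; so for [X] close to [P] the width is still attained at
    that pair unless it drops below [2 + sqrt 2] ([width_dichotomy]).  Write
    [X^-1 = P^-1 (1 - D)].  At these six pairs the differences then exceed
    [2 + sqrt 2] by gains that are linear in [D].

    The gains cannot all be nonnegative.  The sum of the single gains plus
    [sqrt 2] times the sum of the pair gains is [kappa * tr (D P)]
    ([sum_gains]).  As [D X = X - P] has zero diagonal, [tr (D P)] equals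
    [- tr (D D X)], so the first variation of this positive combination of
    widths vanishes.  If no gain is negative, the squares of the gains add up
    to at most [(kappa * tr (D P)) ^ 2], hence they are controlled by
    [tr (D P)] itself, which is small.  So [D] nearly lies in the space where
    the six gains and the diagonal of [D P] vanish; on that space the
    quadratic form [tr (D D P)] is positive definite ([gain_form_ge]).  The
    margin absorbs the difference between [P] and [X], and
    [tr (D D X) <= 0] forces [D = 0], that is, [X = P]
    ([gains_ge0_rigid], [short_functional]).

    For [Lambda] itself, a lattice functional is [(a, b, c) / 4] with integers
    [a], [b], [c] of the same parity, and a look at the signs gives two
    vertices on which its values differ by at least [2 + sqrt 2]
    ([Lambda_width_ge]). *)

Set Implicit Arguments.
Unset Strict Implicit.
Unset Printing Implicit Defensive.

Import Order.TTheory GRing.Theory Num.Theory.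
Import numFieldNormedType.Exports.

Local Open Scope ring_scope.

(** * Indices modulo 4 *)

Local Notation i0 := (@Ordinal 4 0 isT).
Local Notation i1 := (@Ordinal 4 1 isT).
Local Notation i2 := (@Ordinal 4 2 isT).
Local Notation i3 := (@Ordinal 4 3 isT).

Lemma sum4 (V : nmodType) (F : 'I_4 -> V) :
  \sum_i F i = F i0 + F i1 + F i2 + F i3.
Proof.
rewrite !big_ord_recl big_ord0 addr0 !addrA.
by do !congr (_ + _); congr F; apply: val_inj.
Qed.

Lemma forall4 (Q : 'I_4 -> Prop) :
  Q i0 -> Q i1 -> Q i2 -> Q i3 -> forall i, Q i.
Proof.
move=> Q0 Q1 Q2 Q3 [k ltk].
by case: k ltk => [|[|[|[|//]]]] ltk;
  [move: Q0|move: Q1|move: Q2|move: Q3]; congr Q; apply: val_inj.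
Qed.

(** The zmodule ['I_4] provides the cyclic successor [i + 1]. *)
Lemma shift4 :
  ((((i0 + 1 = i1)%R * (i1 + 1 = i2)%R) * ((i2 + 1 = i3)%R * (i3 + 1 = i0)%R)) *
   (((i0 - 1 = i3)%R * (i1 - 1 = i0)%R) * ((i2 - 1 = i1)%R * (i3 - 1 = i2)%R)))%type.
Proof. by do !split; apply: val_inj. Qed.

Definition circ {R : nmodType} (a b c d : R) : 'M[R]_4 :=
  \matrix_(i, j) (nth [::] [:: [:: a; b; c; d]; [:: d; a; b; c];
                               [:: c; d; a; b]; [:: b; c; d; a]] i)`_j.

(** * Positive semidefinite forms in three complex variables *)

(** Sylvester's criterion for a Hermitian form written in real and imaginary
    parts: completing two squares leaves the determinant as the last pivot.
    The scalars [p], [r], [m1], [m2] are the 2 x 2 minors that survive the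
    first elimination step. *)
Lemma hermitian3_ge0 (R : realFieldType) (a d f b1 b2 c1 c2 e1 e2 : R)
    (p := a * d - b1 ^+ 2 - b2 ^+ 2) (r := a * f - c1 ^+ 2 - c2 ^+ 2)
    (m1 := a * e1 - b1 * c1 - b2 * c2) (m2 := a * e2 - b1 * c2 + b2 * c1)
    (x1 x2 y1 y2 z1 z2 : R) :
  0 < a -> 0 < p -> 0 <= p * r - m1 ^+ 2 - m2 ^+ 2 ->
  0 <= a * (x1 ^+ 2 + x2 ^+ 2) + d * (y1 ^+ 2 + y2 ^+ 2)
     + f * (z1 ^+ 2 + z2 ^+ 2)
     + 2 * (b1 * (x1 * y1 + x2 * y2) + b2 * (x1 * y2 - x2 * y1)
          + c1 * (x1 * z1 + x2 * z2) + c2 * (x1 * z2 - x2 * z1)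
          + e1 * (y1 * z1 + y2 * z2) + e2 * (y1 * z2 - y2 * z1)).
Proof.
move=> a0 p0 det0; rewrite -(pmulr_rge0 _ (mulr_gt0 a0 p0)).
have -> : forall u, a * p * u = p * (a * u) by move=> u; ring.
set q := (X in p * X).
have -> : p * q =
    p * ((a * x1 + b1 * y1 + b2 * y2 + c1 * z1 + c2 * z2) ^+ 2 +
         (a * x2 + b1 * y2 - b2 * y1 + c1 * z2 - c2 * z1) ^+ 2) +
    ((p * y1 + m1 * z1 + m2 * z2) ^+ 2 + (p * y2 + m1 * z2 - m2 * z1) ^+ 2) +
    (p * r - m1 ^+ 2 - m2 ^+ 2) * (z1 ^+ 2 + z2 ^+ 2).
  by rewrite /q /p /r /m1 /m2; ring.
by do ![exact: sqr_ge0 | exact: ltW | exact: det0 | apply: addr_ge0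
       | apply: mulr_ge0].
Qed.

Lemma symmetric3_ge0 (R : realFieldType) (a d f b c e x y z : R)
    (p := a * d - b ^+ 2) (r := a * f - c ^+ 2) (m := a * e - b * c) :
  0 < a -> 0 < p -> 0 <= p * r - m ^+ 2 ->
  0 <= a * x ^+ 2 + d * y ^+ 2 + f * z ^+ 2
     + 2 * (b * (x * y) + c * (x * z) + e * (y * z)).
Proof.
move=> a0 p0 det0.
have := @hermitian3_ge0 R a d f b 0 c 0 e 0 x 0 y 0 z 0.
by rewrite !(mulr0, mul0r, expr0n, addr0, subr0) /=; apply.
Qed.

(** * The quadratic form of the second variation *)

Section gain_form.
Context {R : realFieldType}.
Implicit Type D : 'M[R]_4.

(** With [c = 1 + sqrt 2] this is what [D] adds, for [X^-1 = P^-1 (1 - D)], to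
    the longest difference of vertex values of the functional that is 1 at the
    [i]-th lattice point and 0 at the other three ([single_width]).  The
    constant [c] is kept as a variable because a rational value replaces it in
    the positivity proof. *)
Definition single_gain (c : R) D i :=
  D (i + 1) i - D i i + c * (D (i - 1) i - D i i).

(** The same for the functional that is 1 at the points [i + 1] and [i + 2]
    ([pair_width]). *)
Definition pair_gain (c : R) D i :=
  let S k := D k (i + 1) + D k (i + 1 + 1) in
  c * (S i - S (i + 1 + 1)) - (S (i + 1) - S (i - 1)).

(** The weight 2 is the square of the weight [sqrt 2] that the pair gains have
    in [sum_gains]. *)
Definition gains_sq (c : R) D : R :=
  \sum_i single_gain c D i ^+ 2
  + 2 * (pair_gain c D i0 ^+ 2 + pair_gain c D i1 ^+ 2).

Definition sqnorm D : R := \sum_i \sum_j D i j ^+ 2.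

(** A rational circulant within 1/280 of the matrix [P] of the barycentric
    coordinates of the points [pt i]. *)
Definition bary_approx : 'M[R]_4 := circ 0 (1 / 4) (7 / 20) (2 / 5).

(** The difference of the two sides of [gain_form_ge] is a quadratic form
    invariant under the cyclic shift of the indices, so a discrete Fourier
    transform along the bands [D i (i + t)], [t = 1, 2, 3], splits it into a
    block for each fourth root of unity.  Here is 625 times its value when the
    three bands are constant, equal to [x], [y] and [z]. *)
Lemma constant_mode_ge0 (x y z : R) :
  0 <= 21779 * x ^+ 2 + 19990 * y ^+ 2 + 8633 * z ^+ 2
     + 2 * (19808 * (x * y) + 12661 * (x * z) + 11318 * (y * z)).
Proof. by apply: symmetric3_ge0; lra. Qed.

(** 625 times the value of the same form when the bands alternate in sign. *)
Lemma alternating_mode_ge0 (x y z : R) :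
  0 <= 12237 * x ^+ 2 + 8470 * y ^+ 2 + 4053 * z ^+ 2
     + 2 * (9527 * (x * y) + 1590 * (x * z) + 3143 * (y * z)).
Proof. by apply: symmetric3_ge0; lra. Qed.

(** The two imaginary roots of unity together: 2500 times the value of the
    same form when the bands are [x1, x2, - x1, - x2], and likewise for [y]
    and [z]. *)
Lemma quarter_mode_ge0 (x1 y1 z1 x2 y2 z2 : R) :
  0 <= 20192 * (x1 ^+ 2 + x2 ^+ 2) + 15736 * (y1 ^+ 2 + y2 ^+ 2)
     + 10286 * (z1 ^+ 2 + z2 ^+ 2)
     + 2 * (16011 * (x1 * y1 + x2 * y2) + 4521 * (x1 * y2 - x2 * y1)
          + 11371 * (x1 * z1 + x2 * z2) + 5311 * (x1 * z2 - x2 * z1)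
          + 11811 * (y1 * z1 + y2 * z2) + 2415 * (y1 * z2 - y2 * z1)).
Proof. by apply: hermitian3_ge0; lra. Qed.

(** The trace form alone is indefinite.  It is positive where the gains and
    the diagonal of [D P] vanish, and enough of the squares of these linear
    forms makes it positive everywhere. *)
Lemma gain_form_ge D : (forall i, \sum_j D i j = 0) ->
  sqnorm D / 10 <= \tr (D *m D *m bary_approx) + 3 / 25 * gains_sq (12 / 5) D
                   + 16 * \sum_i (D *m bary_approx) i i ^+ 2.
Proof.
move=> D0; rewrite /sqnorm /gains_sq /single_gain /pair_gain /mxtrace.
have := D0 i0; have := D0 i1; have := D0 i2; have := D0 i3.
rewrite !sum4 !mxE !sum4 !mxE !sum4 !shift4 /=.
move: (D i0 i0 : R) (D i0 i1 : R) (D i0 i2 : R) (D i0 i3 : R)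
  (D i1 i0 : R) (D i1 i1 : R) (D i1 i2 : R) (D i1 i3 : R)
  (D i2 i0 : R) (D i2 i1 : R) (D i2 i2 : R) (D i2 i3 : R)
  (D i3 i0 : R) (D i3 i1 : R) (D i3 i2 : R) (D i3 i3 : R).
move=> d00 d01 d02 d03 d10 d11 d12 d13 d20 d21 d22 d23 d30 d31 d32 d33.
move=> h3 h2 h1 h0.
have -> : d00 = - (d01 + d02 + d03) by lra.
have -> : d11 = - (d12 + d13 + d10) by lra.
have -> : d22 = - (d23 + d20 + d21) by lra.
have -> : d33 = - (d30 + d31 + d32) by lra.
have := constant_mode_ge0 (d01 + d12 + d23 + d30) (d02 + d13 + d20 + d31)
  (d03 + d10 + d21 + d32).
have := alternating_mode_ge0 (d01 - d12 + d23 - d30) (d02 - d13 + d20 - d31)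
  (d03 - d10 + d21 - d32).
have := quarter_mode_ge0 (d01 - d23) (d02 - d20) (d03 - d21)
  (d12 - d30) (d13 - d31) (d10 - d32).
by clear; lra.
Qed.

Lemma sqnorm_ge0 D : 0 <= sqnorm D.
Proof. by apply: sumr_ge0 => i _; apply: sumr_ge0 => j _; exact: sqr_ge0. Qed.

Lemma sqnorm_le0 D : sqnorm D <= 0 -> D = 0.
Proof.
move=> h; have : sqnorm D == 0 by rewrite eq_le h sqnorm_ge0.
rewrite psumr_eq0 => [/allP h1|i _]; last first.
  by apply: sumr_ge0 => j _; exact: sqr_ge0.
apply/matrixP => i j; have := h1 i (mem_index_enum i).
rewrite psumr_eq0 => [/allP h2|k _]; last exact: sqr_ge0.
by have := h2 j (mem_index_enum j); rewrite sqrf_eq0 !mxE => /eqP.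
Qed.

(** * Stability of the quadratic form *)

Lemma trace_sqr_mul_le e D (X : 'M[R]_4) : (forall i j, `|X i j| <= e) ->
  `|\tr (D *m D *m X)| <= 4 * e * sqnorm D.
Proof.
move=> Xe; have e0 : 0 <= e := le_trans (normr_ge0 _) (Xe i0 i0).
have h i j k : `|D i j * D j k * X k i| <= e * ((D i j ^+ 2 + D j k ^+ 2) / 2).
  rewrite normrM mulrC ler_pM ?normr_ge0 ?Xe// normrM.
  rewrite -[D i j ^+ 2]real_normK ?num_real//.
  rewrite -[D j k ^+ 2]real_normK ?num_real//.
  by have := sqr_ge0 (`|D i j| - `|D j k|); nra.
have -> : \tr (D *m D *m X) = \sum_i \sum_k \sum_j D i j * D j k * X k i.
  rewrite /mxtrace; apply: eq_bigr => i _; rewrite mxE; apply: eq_bigr => k _.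
  by rewrite mxE mulr_suml.
have -> : 4 * e * sqnorm D =
    \sum_i \sum_k \sum_j e * ((D i j ^+ 2 + D j k ^+ 2) / 2).
  by rewrite /sqnorm !sum4; field.
do 3 (apply: (le_trans (ler_norm_sum _ _ _)); apply: ler_sum => ? _).
exact: h.
Qed.

Lemma diag_mul_sqr_le e D (X : 'M[R]_4) i : (forall i j, `|X i j| <= e) ->
  (D *m X) i i ^+ 2 <= 4 * e ^+ 2 * \sum_j D i j ^+ 2.
Proof.
move=> Xe; have e0 : 0 <= e := le_trans (normr_ge0 _) (Xe i0 i0).
have h j : (D i j * X j i) ^+ 2 <= e ^+ 2 * D i j ^+ 2.
  rewrite exprMn mulrC ler_wpM2r ?sqr_ge0// -real_normK ?num_real//.
  by rewrite lerXn2r ?nnegrE.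
rewrite !mxE !sum4.
have := h i0; have := h i1; have := h i2; have := h i3.
move: (D i i0 * X i0 i) (D i i1 * X i1 i) (D i i2 * X i2 i) (D i i3 * X i3 i).
move=> a b c d.
have := sqr_ge0 (a - b); have := sqr_ge0 (a - c); have := sqr_ge0 (a - d).
have := sqr_ge0 (b - c); have := sqr_ge0 (b - d); have := sqr_ge0 (c - d).
lra.
Qed.

(** Young's inequality: replacing the slope [t] by a value within 3/200 of it
    costs a small fraction of the square and of the square of [b]. *)
Lemma young_sqr (a b t : R) : 2414 / 1000 <= t <= 2415 / 1000 ->
  24 / 25 * (a + 12 / 5 * b) ^+ 2 - b ^+ 2 / 185 <= (a + t * b) ^+ 2.
Proof.
move=> /andP[t1 t2]; pose e := t - 12 / 5.
have e2 : 24 * e ^+ 2 <= 1 / 185 by rewrite /e; nra.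
rewrite (_ : t = 12 / 5 + e); last by rewrite /e; lra.
have := sqr_ge0 ((a + 12 / 5 * b) / 5 + 5 * e * b).
have : 0 <= b ^+ 2 * (1 / 185 - 24 * e ^+ 2) by rewrite mulr_ge0 ?sqr_ge0//; lra.
lra.
Qed.

Lemma sqr4_le (x y z w : R) :
  (x + y - (z + w)) ^+ 2 <= 4 * (x ^+ 2 + y ^+ 2 + (z ^+ 2 + w ^+ 2)).
Proof.
have := sqr_ge0 (x - y); have := sqr_ge0 (z - w).
have := sqr_ge0 (x + z); have := sqr_ge0 (x + w).
by have := sqr_ge0 (y + z); have := sqr_ge0 (y + w); lra.
Qed.

Lemma gains_sq_ge D t : 2414 / 1000 <= t <= 2415 / 1000 ->
  24 / 25 * gains_sq (12 / 5) D - 10 / 185 * sqnorm D <= gains_sq t D.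
Proof.
move=> tb; pose b i := D (i - 1) i - D i i.
pose c i := D i (i + 1) + D i (i + 1 + 1)
  - (D (i + 1 + 1) (i + 1) + D (i + 1 + 1) (i + 1 + 1)).
have hs i : 24 / 25 * single_gain (12 / 5) D i ^+ 2 - b i ^+ 2 / 185
    <= single_gain t D i ^+ 2 by exact: young_sqr.
have hp i : 24 / 25 * pair_gain (12 / 5) D i ^+ 2 - c i ^+ 2 / 185
    <= pair_gain t D i ^+ 2.
  have := young_sqr (- (D (i + 1) (i + 1) + D (i + 1) (i + 1 + 1)
    - (D (i - 1) (i + 1) + D (i - 1) (i + 1 + 1)))) (c i) tb.
  by rewrite /pair_gain /= -/(c i) ![- _ + _ * _]addrC.
have : \sum_i b i ^+ 2 + 2 * (c i0 ^+ 2 + c i1 ^+ 2) <= 10 * sqnorm D.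
  have hb i : b i ^+ 2 <= 2 * (D (i - 1) i ^+ 2 + D i i ^+ 2).
    by rewrite /b; have := sqr_ge0 (D (i - 1) i + D i i); lra.
  have hc i : c i ^+ 2 <= 4 * (D i (i + 1) ^+ 2 + D i (i + 1 + 1) ^+ 2 +
      (D (i + 1 + 1) (i + 1) ^+ 2 + D (i + 1 + 1) (i + 1 + 1) ^+ 2)).
    exact: sqr4_le.
  have := hb i0; have := hb i1; have := hb i2; have := hb i3.
  have := hc i0; have := hc i1; rewrite /sqnorm !sum4 !shift4.
  have P i j := sqr_ge0 (D i j).
  have := P i0 i0; have := P i0 i3; have := P i0 i2; have := P i0 i1.
  have := P i1 i0; have := P i1 i3; have := P i1 i2; have := P i1 i1.
  have := P i2 i0; have := P i2 i3; have := P i2 i2; have := P i2 i1.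
  have := P i3 i0; have := P i3 i3; have := P i3 i2; have := P i3 i1.
  lra.
rewrite /gains_sq !sum4.
have := hs i0; have := hs i1; have := hs i2; have := hs i3.
by have := hp i0; have := hp i1; lra.
Qed.

(** The margin 1/10 of [gain_form_ge] exceeds the three errors together: 4/60
    from the trace, 16 * 4/3600 from the diagonal terms, and 10/(8 * 185) from
    the value 12/5 in place of [t]. *)
Lemma second_variation_rigid D (X : 'M[R]_4) t :
  2414 / 1000 <= t <= 2415 / 1000 -> (forall i, \sum_j D i j = 0) ->
  (forall i j, `|(X - bary_approx) i j| <= 1 / 60) ->
  (forall i, (D *m X) i i = 0) ->
  gains_sq t D <= - 8 * \tr (D *m D *m X) -> D = 0.
Proof.
move=> tb D0 XP DX h; apply: sqnorm_le0.
have := gain_form_ge D0; have := gains_sq_ge D tb.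
have := trace_sqr_mul_le D XP.
rewrite mulmxBr linearB /= ler_norml => /andP[+ _].
have : \sum_i (D *m bary_approx) i i ^+ 2 <= 4 * (1 / 60) ^+ 2 * sqnorm D.
  rewrite /sqnorm mulr_sumr; apply: ler_sum => i _.
  apply: le_trans (diag_mul_sqr_le D i XP).
  by rewrite mulmxBr [(D *m X - _) i i]mxE [X in _ + X]mxE DX sub0r sqrrN.
by have := sqnorm_ge0 D; lra.
Qed.

End gain_form.

(** * Perturbation of an inverse matrix *)

Lemma row_l1_mul (R : realFieldType) n (A B : 'M[R]_n) a b i :
  (forall k, \sum_j `|B k j| <= b) -> \sum_j `|A i j| <= a -> 0 <= b ->
  \sum_j `|(A *m B) i j| <= a * b.
Proof.
move=> Bb Aa b0; apply: (@le_trans _ _ (\sum_j \sum_k `|A i k| * `|B k j|)).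
  apply: ler_sum => j _; rewrite mxE; apply: le_trans (ler_norm_sum _ _ _) _.
  by apply: ler_sum => k _; rewrite normrM.
apply: le_trans (ler_wpM2r b0 Aa).
rewrite exchange_big mulr_suml; apply: ler_sum => k _.
by rewrite -mulr_sumr ler_wpM2l.
Qed.

(** The bound of the Neumann series, without the series: a kernel vector [v]
    of [1 + K] satisfies [v = - v K], whose l1 norm is at most [r] times that
    of [v], and the identity [D = K - D K] bounds the rows of [D] in the same
    way. *)
Lemma neumann_inverse (R : realFieldType) n (K : 'M[R]_n) r :
  r < 1 -> (forall i, \sum_j `|K i j| <= r) ->
  exists D, [/\ (1%:M + K) *m (1%:M - D) = 1%:M,
    (1%:M - D) *m (1%:M + K) = 1%:M & forall i, \sum_j `|D i j| <= r / (1 - r)].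
Proof.
move=> r1 Kr.
have l1 (v : 'rV[R]_n) : \sum_j `|(v *m K) 0 j| <= r * \sum_i `|v 0 i|.
  apply: (@le_trans _ _ (\sum_j \sum_i `|v 0 i| * `|K i j|)).
    apply: ler_sum => j _; rewrite mxE; apply: le_trans (ler_norm_sum _ _ _) _.
    by apply: ler_sum => i _; rewrite normrM.
  rewrite exchange_big mulr_sumr; apply: ler_sum => i _.
  by rewrite -mulr_sumr mulrC ler_wpM2r.
have KU : 1%:M + K \in unitmx.
  rewrite -row_free_unit -kermx_eq0; apply/rowV0P => v /sub_kermxP.
  rewrite mulmxDr mulmx1 => /eqP; rewrite addr_eq0 => /eqP vK.
  have v0 : \sum_i `|v 0 i| <= r * \sum_i `|v 0 i|.
    apply: le_trans (l1 v); rewrite {1}vK; apply: ler_sum => j _.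
    by rewrite mxE normrN.
  have /eqP : \sum_i `|v 0 i| == 0.
    rewrite eq_le sumr_ge0// andbT -(pmulr_rle0 _ (_ : 0 < 1 - r)) ?subr_gt0//.
    by rewrite mulrBl mul1r subr_le0.
  move/psumr_eq0P => vz; apply/rowP => j; rewrite mxE; apply: normr0_eq0.
  by rewrite vz.
set W := invmx (1%:M + K).
have [KW WK] : (1%:M + K) *m W = 1%:M /\ W *m (1%:M + K) = 1%:M.
  by split; [exact: mulmxV|exact: mulVmx].
exists (1%:M - W); rewrite subKr; split=> // i.
have rowD : row i (1%:M - W) = row i K - row i (1%:M - W) *m K.
  rewrite -row_mul -linearB; congr row.
  rewrite mulmxBl mul1mx opprB addrCA subrr addr0.
  by rewrite -[in LHS]WK mulmxDr mulmx1 addrC addKr.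
have rE j : (1%:M - W) i j = row i (1%:M - W) 0 j by rewrite [RHS]mxE.
under eq_bigr do rewrite rE.
rewrite ler_pdivlMr ?subr_gt0// mulrBr mulr1 lerBlDr mulrC.
apply: le_trans (lerD (Kr i) (l1 _)); rewrite -big_split {1}rowD.
apply: ler_sum => j _; rewrite mxE [X in _ + X]mxE [row i K 0 j]mxE.
exact: ler_normB.
Qed.

(** * The barycentric matrix of the tetrahedron *)

Section tetrahedron_matrix.
Context {R : rcfType}.
Local Notation s2 := (Num.sqrt 2 : R).
Implicit Types (D X : 'M[R]_4) (A : {set 'I_4}).

Lemma sqr_s2 : s2 ^+ 2 = 2.
Proof. by rewrite sqr_sqrtr. Qed.

(** A convergent of [sqrt 2] and 2 divided by it: precise bounds with small
    numerators, which keep the linear arithmetic below cheap. *)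
Lemma s2_bounds : 140 / 99 <= s2 <= 99 / 70.
Proof.
have := sqr_s2; have : 0 <= s2 by exact: sqrtr_ge0.
by move=> ? ?; apply/andP; split; nra.
Qed.

Lemma s2_coarse : 7 / 5 <= s2 <= 29 / 20.
Proof. by have /andP[s1 s3] := s2_bounds; apply/andP; split; lra. Qed.

(** Row [i] holds the barycentric coordinates of [pt i] ([ptE]). *)
Definition bary_pt : 'M[R]_4 := circ 0 (1 / 4) (s2 / 4) ((3 - s2) / 4).

Definition inv_bary_pt : 'M[R]_4 :=
  circ (- (3 + 3 * s2) / 4) ((5 + s2) / 4) ((1 + s2) / 4) ((1 + s2) / 4).

Lemma mul_inv_bary_pt : inv_bary_pt *m bary_pt = 1%:M.
Proof.
have s22 := sqr_s2.
by apply/matrixP; apply: forall4; apply: forall4; rewrite !mxE sum4 !mxE /=;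
  field: s22.
Qed.

Lemma mul_bary_pt_inv : bary_pt *m inv_bary_pt = 1%:M.
Proof. exact: mulmx1C mul_inv_bary_pt. Qed.

Lemma bary_pt_diag i : bary_pt i i = 0.
Proof. by move: i; apply: forall4; rewrite !mxE. Qed.

Lemma bary_pt_row_sum i : \sum_j bary_pt i j = 1.
Proof. by move: i; apply: forall4; rewrite sum4 !mxE /=; lra. Qed.

Lemma inv_bary_pt_l1 k : \sum_j `|inv_bary_pt k j| <= 4623 / 1000.
Proof.
have /andP[s1 s3] := s2_bounds.
have n0 : `|- (3 + 3 * s2) / 4| = (3 + 3 * s2) / 4.
  by rewrite mulNr normrN ger0_norm//; lra.
have n1 : `|(5 + s2) / 4| = (5 + s2) / 4 by rewrite ger0_norm//; lra.
have n2 : `|(1 + s2) / 4| = (1 + s2) / 4 by rewrite ger0_norm//; lra.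
by move: k; apply: forall4; rewrite sum4 !mxE /= n0 n1 n2; lra.
Qed.

(** Sharper than twice [inv_bary_pt_l1]; the gap argument of
    [width_dichotomy] needs a value below 9. *)
Lemma inv_bary_pt_row_dist j l :
  \sum_k `|inv_bary_pt j k - inv_bary_pt l k| <= 69 / 10.
Proof.
have /andP[s1 s3] := s2_coarse.
have n01 : `|- (3 + 3 * s2) / 4 - (5 + s2) / 4| = 2 + s2.
  by rewrite ler0_norm; lra.
have n10 : `|(5 + s2) / 4 - - (3 + 3 * s2) / 4| = 2 + s2.
  by rewrite ger0_norm; lra.
have n02 : `|- (3 + 3 * s2) / 4 - (1 + s2) / 4| = 1 + s2.
  by rewrite ler0_norm; lra.
have n20 : `|(1 + s2) / 4 - - (3 + 3 * s2) / 4| = 1 + s2.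
  by rewrite ger0_norm; lra.
have n12 : `|(5 + s2) / 4 - (1 + s2) / 4| = 1 by rewrite ger0_norm; lra.
have n21 : `|(1 + s2) / 4 - (5 + s2) / 4| = 1 by rewrite ler0_norm; lra.
move: j l; apply: forall4; apply: forall4; rewrite sum4 !mxE /=;
  rewrite ?(n01, n10, n02, n20, n12, n21, subrr, normr0); lra.
Qed.

Lemma row_sum0 D :
  (forall i, \sum_j D i j = 0) <-> D *m const_mx 1 = 0 :> 'cV_4.
Proof.
have E i : (D *m const_mx 1 : 'cV_4) i 0 = \sum_j D i j.
  by rewrite mxE; apply: eq_bigr => j _; rewrite mxE mulr1.
split=> h; first by apply/colP => i; rewrite E h mxE.
by move=> i; rewrite -E h mxE.
Qed.

(** With [K = (X - P) P^-1] one has [X = (1 + K) P], so [D] comes from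
    [neumann_inverse].  A row of [X - P] has three entries of size at most
    0.01307, hence the rows of [K] have l1 norm at most 2/11. *)
Lemma perturbed_inverse X : (forall i, X i i = 0) ->
  (forall i, \sum_j X i j = 1) ->
  (forall i j, `|X i j - bary_pt i j| <= 1307 / 10 ^+ 5) ->
  exists D, [/\ X *m (inv_bary_pt *m (1%:M - D)) = 1%:M,
    D *m X = X - bary_pt, forall i, \sum_j D i j = 0
    & forall i, \sum_j `|D i j| <= 2 / 9].
Proof.
move=> X0 X1 XP; set E := X - bary_pt; set G := inv_bary_pt.
have Ei i : E i i = 0 by rewrite [E i i]mxE [(- bary_pt) i i]mxE bary_pt_diag X0 subr0.
have El1 i : \sum_j `|E i j| <= 3 * (1307 / 10 ^+ 5).
  rewrite (bigD1 i)//= Ei normr0 add0r.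
  apply: (@le_trans _ _ (\sum_(j | j != i) (1307 / 10 ^+ 5 : R))).
    by apply: ler_sum => j _; rewrite [E i j]mxE [(- bary_pt) i j]mxE.
  by rewrite sumr_const cardC1 card_ord -[X in X <= _]mulr_natl.
have [|i|D [KD DK Dl1]] := @neumann_inverse R 4 (E *m G) (2 / 11).
- lra.
- by apply: le_trans (row_l1_mul inv_bary_pt_l1 (El1 i) _) _; lra.
have XE : (1%:M + E *m G) *m bary_pt = X.
  by rewrite mulmxDl mul1mx -mulmxA mul_inv_bary_pt mulmx1 addrC subrK.
have DKE : D *m (1%:M + E *m G) = E *m G.
  by move: DK; rewrite mulmxBl mul1mx => /(canRL (subrK _)) /addrI {2}->.
exists D; split=> [|||i].
- by rewrite -{1}XE mulmxA -[_ *m _ *m G]mulmxA mul_bary_pt_inv mulmx1.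
- by rewrite -{1}XE mulmxA DKE -mulmxA mul_inv_bary_pt mulmx1.
- apply/row_sum0.
  have G1 : G *m const_mx 1 = const_mx 1 :> 'cV_4.
    by apply/colP; apply: forall4; rewrite !mxE sum4 !mxE /=; lra.
  have P1 : bary_pt *m const_mx 1 = const_mx 1 :> 'cV_4.
    by rewrite -{1}G1 mulmxA mul_bary_pt_inv mul1mx.
  have K1 : E *m G *m const_mx 1 = 0 :> 'cV_4.
    rewrite -mulmxA G1 mulmxBl P1.
    apply/eqP; rewrite subr_eq0; apply/eqP/colP => i.
    rewrite !mxE; apply: etrans (X1 i).
    by apply: eq_bigr => j _; rewrite mxE mulr1.
  have : D *m (1%:M + E *m G) *m const_mx 1 = 0 :> 'cV_4 by rewrite DKE K1.
  by rewrite -mulmxA mulmxDl mul1mx K1 addr0.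
- apply: le_trans (Dl1 i) _.
  by rewrite (_ : _ / (1 - _) = 2 / 9) //; field.
Qed.

(** * The six functionals *)

Definition char_col A : 'cV[R]_4 := \col_i (i \in A)%:R.

(** Values at the vertices of the affine functional that is the indicator of
    [A] on the points whose barycentric matrix is the inverse of
    [inv_bary_pt (1 - D)]. *)
Definition vertex_values D A : 'cV[R]_4 :=
  inv_bary_pt *m (1%:M - D) *m char_col A.

Lemma mul_char_col (M : 'M[R]_4) A k :
  (M *m char_col A) k 0 = \sum_(i in A) M k i.
Proof.
rewrite mxE [RHS]big_mkcond; apply: eq_bigr => i _; rewrite mxE.
by case: (i \in A); rewrite ?mulr1 ?mulr0.
Qed.

Lemma vertex_valuesE D A k : vertex_values D A k 0 =
  \sum_(i in A) inv_bary_pt k i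
  - \sum_m inv_bary_pt k m * \sum_(i in A) D m i.
Proof.
rewrite /vertex_values -mulmxA mulmxBl mul1mx mulmxBr mxE [X in _ + X]mxE.
rewrite mul_char_col; congr (_ - _).
by rewrite mxE; apply: eq_bigr => m _; rewrite mul_char_col.
Qed.

(** The sum over [A] and the sum over its complement are opposite, and both
    count in the l1 norm. *)
Lemma sum_half_l1 (I : finType) (a : I -> R) (A : {set I}) :
  \sum_i a i = 0 -> 2 * `|\sum_(i in A) a i| <= \sum_i `|a i|.
Proof.
rewrite (bigID (mem A))/= => /eqP; rewrite addr_eq0 => /eqP h.
rewrite mulr_natl mulr2n [in leRHS](bigID (mem A))/=.
by rewrite lerD ?ler_norm_sum// h normrN ler_norm_sum.
Qed.

(** The perturbation changes each difference of two vertex values by less than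
    1, which is the gap below [2 + sqrt 2] of every pair other than
    [(top, bot)]. *)
Lemma width_dichotomy D A (top bot : 'I_4) :
  (forall i, \sum_j D i j = 0) -> (forall i, \sum_j `|D i j| <= 2 / 9) ->
  (forall j l, (j == top) && (l == bot) \/
     \sum_(i in A) inv_bary_pt j i - \sum_(i in A) inv_bary_pt l i <= 1 + s2) ->
  (forall j l, vertex_values D A j 0 - vertex_values D A l 0 < 2 + s2) \/
  2 + s2 <= vertex_values D A top 0 - vertex_values D A bot 0.
Proof.
move=> D0 Dl gap; set F := vertex_values D A.
have FE j l : F j 0 - F l 0 =
    (\sum_(i in A) inv_bary_pt j i - \sum_(i in A) inv_bary_pt l i)
   - \sum_k (inv_bary_pt j k - inv_bary_pt l k) * \sum_(i in A) D k i.
  rewrite /F !vertex_valuesE.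
  by rewrite (eq_bigr _ (fun k _ => mulrBl _ _ _)) sumrB; ring.
have small j l :
    `|\sum_k (inv_bary_pt j k - inv_bary_pt l k) * \sum_(i in A) D k i| < 1.
  apply: (@le_lt_trans _ _
    (\sum_k `|inv_bary_pt j k - inv_bary_pt l k| * (1 / 9))).
    apply: le_trans (ler_norm_sum _ _ _) _; apply: ler_sum => k _.
    rewrite normrM ler_wpM2l//; have := sum_half_l1 A (D0 k).
    by have := Dl k; lra.
  by rewrite -mulr_suml; have := inv_bary_pt_row_dist j l; lra.
have [|lt_tb] := lerP (2 + s2) (F top 0 - F bot 0); first by right.
left=> j l; have [/andP[/eqP-> /eqP->]//|] := gap j l.
by rewrite FE; have := small j l; rewrite ltr_norml => /andP[? ?]; lra.
Qed.

Lemma single_gap (i j l : 'I_4) : (j == i - 1) && (l == i) \/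
  \sum_(k in [set i]%SET) inv_bary_pt j k
  - \sum_(k in [set i]%SET) inv_bary_pt l k <= 1 + s2.
Proof.
have /andP[s1 s3] := s2_coarse.
rewrite !big_set1; move: i j l; do 3 apply: forall4; rewrite !shift4 !mxE /=;
  first [by left|right; lra].
Qed.

Lemma single_width D i : (forall i, \sum_j D i j = 0) ->
  let F := vertex_values D [set i]%SET in
  F (i - 1) 0 - F i 0 = 2 + s2 + single_gain (1 + s2) D i.
Proof.
move=> D0 F; have E k : F k 0 = inv_bary_pt k i - \sum_m inv_bary_pt k m * D m i.
  rewrite /F vertex_valuesE big_set1; congr (_ - _).
  by apply: eq_bigr => m _; rewrite big_set1.
rewrite !E !sum4 /single_gain; move: i {F E}; apply: forall4;
  rewrite !shift4 !mxE /=; lra.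
Qed.

Lemma notin_consecutive (i : 'I_4) : i = i0 \/ i = i1 ->
  i + 1 \notin [set i + 1 + 1]%SET.
Proof. by move=> ii; rewrite inE; case: ii => ->; rewrite !shift4. Qed.

(** The indices 2 and 3 would give the complements of these pairs, that is,
    the same functionals up to sign and an additive constant. *)
Lemma pair_gap (i j l : 'I_4) : i = i0 \/ i = i1 ->
  (j == i) && (l == i + 1 + 1) \/
  \sum_(k in [set i + 1; i + 1 + 1]%SET) inv_bary_pt j k -
  \sum_(k in [set i + 1; i + 1 + 1]%SET) inv_bary_pt l k <= 1 + s2.
Proof.
have /andP[s1 s3] := s2_coarse.
move=> ii; rewrite !(big_setU1 _ (notin_consecutive ii))/= !big_set1.
case: ii => ->; move: j l; do 2 apply: forall4; rewrite !shift4 !mxE /=;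
  first [by left|right; lra].
Qed.

Lemma pair_width D (i : 'I_4) : i = i0 \/ i = i1 ->
  (forall i, \sum_j D i j = 0) ->
  let F := vertex_values D [set i + 1; i + 1 + 1]%SET in
  F i 0 - F (i + 1 + 1) 0 = 2 + s2 + pair_gain (1 + s2) D i.
Proof.
move=> ii D0 F; have ni := notin_consecutive ii.
have E k : F k 0 = inv_bary_pt k (i + 1) + inv_bary_pt k (i + 1 + 1)
   - \sum_m inv_bary_pt k m * (D m (i + 1) + D m (i + 1 + 1)).
  rewrite /F vertex_valuesE big_setU1//= big_set1; congr (_ - _).
  by apply: eq_bigr => m _; rewrite big_setU1//= big_set1.
rewrite !E !sum4 /pair_gain; case: ii => ->; rewrite !shift4 !mxE /=; lra.
Qed.

(** * Six nonnegative gains force equality *)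

(** The weights 1 and [sqrt 2] are the Lagrange multipliers for which the
    linear form depends on the diagonal of [D P] only, up to the row sums of
    [D]; the constant is [4 (1 + sqrt 2)^2]. *)
Lemma sum_gains D : (forall i, \sum_j D i j = 0) ->
  \sum_i single_gain (1 + s2) D i
  + s2 * (pair_gain (1 + s2) D i0 + pair_gain (1 + s2) D i1)
  = (12 + 8 * s2) * \tr (D *m bary_pt).
Proof.
move=> D0; have s22 := sqr_s2.
rewrite /single_gain /pair_gain /mxtrace.
have := D0 i0; have := D0 i1; have := D0 i2; have := D0 i3.
rewrite !sum4 !mxE !sum4 !mxE !shift4 /=.
move: (D i0 i0 : R) (D i0 i1 : R) (D i0 i2 : R) (D i0 i3 : R)
  (D i1 i0 : R) (D i1 i1 : R) (D i1 i2 : R) (D i1 i3 : R)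
  (D i2 i0 : R) (D i2 i1 : R) (D i2 i2 : R) (D i2 i3 : R)
  (D i3 i0 : R) (D i3 i1 : R) (D i3 i2 : R) (D i3 i3 : R).
move=> d00 d01 d02 d03 d10 d11 d12 d13 d20 d21 d22 d23 d30 d31 d32 d33.
move=> h3 h2 h1 h0.
have -> : d00 = - (d01 + d02 + d03) by lra.
have -> : d11 = - (d12 + d13 + d10) by lra.
have -> : d22 = - (d23 + d20 + d21) by lra.
have -> : d33 = - (d30 + d31 + d32) by lra.
by field: s22.
Qed.

Lemma trace_mul_le D (E : 'M[R]_4) a e : (forall i j, `|E i j| <= e) ->
  (forall i, \sum_j `|D i j| <= a) -> `|\tr (D *m E)| <= 4 * a * e.
Proof.
move=> Ee Da; have e0 : 0 <= e := le_trans (normr_ge0 _) (Ee i0 i0).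
apply: le_trans (ler_norm_sum _ _ _) _.
apply: (@le_trans _ _ (\sum_(i < 4) a * e)); last by rewrite sum4; lra.
apply: ler_sum => i _; rewrite mxE; apply: le_trans (ler_norm_sum _ _ _) _.
apply: le_trans (ler_wpM2r e0 (Da i)); rewrite mulr_suml.
by apply: ler_sum => j _; rewrite normrM ler_wpM2l.
Qed.

(** Each weighted term is at most the total [F], so its square is at most [F]
    times the term. *)
Lemma sum_sqr_le (a b c d x y s F : R) : s ^+ 2 = 2 -> 0 <= s ->
  0 <= a -> 0 <= b -> 0 <= c -> 0 <= d -> 0 <= x -> 0 <= y ->
  F = a + b + c + d + s * (x + y) ->
  a ^+ 2 + b ^+ 2 + c ^+ 2 + d ^+ 2 + 2 * (x ^+ 2 + y ^+ 2) <= F ^+ 2.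
Proof.
move=> s22 s0 a0 b0 c0 d0 x0 y0 FE.
have sx0 := mulr_ge0 s0 x0; have sy0 := mulr_ge0 s0 y0.
have -> : a ^+ 2 + b ^+ 2 + c ^+ 2 + d ^+ 2 + 2 * (x ^+ 2 + y ^+ 2) =
    a * a + b * b + c * c + d * d + (s * x) * (s * x) + (s * y) * (s * y).
  by ring: s22.
have -> : F ^+ 2 =
    a * F + b * F + c * F + d * F + (s * x) * F + (s * y) * F.
  by rewrite expr2 {1}FE; ring.
by rewrite !lerD// ler_wpM2l// FE; lra.
Qed.

Lemma gains_ge0_rigid D X : (forall i, X i i = 0) ->
  (forall i j, `|X i j - bary_pt i j| <= 1307 / 10 ^+ 5) ->
  D *m X = X - bary_pt -> (forall i, \sum_j D i j = 0) ->
  (forall i, \sum_j `|D i j| <= 2 / 9) ->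
  (forall i, 0 <= single_gain (1 + s2) D i) ->
  0 <= pair_gain (1 + s2) D i0 -> 0 <= pair_gain (1 + s2) D i1 -> D = 0.
Proof.
move=> X0 XP DX D0 Dl sg p0 p1.
have s22 := sqr_s2; have /andP[s1 s3] := s2_bounds.
have DXd i : (D *m X) i i = 0.
  by rewrite DX [LHS]mxE [X in _ + X]mxE bary_pt_diag X0 subr0.
set tau := \tr (D *m D *m X).
have tauE : tau = \tr (D *m (X - bary_pt)) by rewrite -DX mulmxA.
have tau_small : `|tau| <= 12 / 1000.
  rewrite tauE.
  apply: (@le_trans _ _ (4 * (2 / 9) * (1307 / 10 ^+ 5))); last by lra.
  by apply: trace_mul_le => // i j; rewrite mxE [X in _ + X]mxE.
(* The trace of [D X] vanishes, so the first-order term is of second order. *)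
have trDP : \tr (D *m bary_pt) = - tau.
  rewrite tauE mulmxBr linearB /= opprB [\tr (D *m X)](_ : _ = 0) ?subr0//.
  by rewrite /mxtrace big1.
apply: (@second_variation_rigid _ D X (1 + s2)) => //.
- by apply/andP; split; lra.
- move=> i j; rewrite mxE [X in _ + X]mxE.
  have -> : X i j - bary_approx i j =
      (X i j - bary_pt i j) + (bary_pt i j - bary_approx i j) by ring.
  apply: le_trans (ler_normD _ _) _.
  have : `|bary_pt i j - bary_approx i j| <= 1 / 280.
    clear -s1 s3; move: i j; do 2 apply: forall4;
      rewrite !mxE /= ler_norml; apply/andP; split; lra.
  by have := XP i j; lra.
have := sum_gains D0; rewrite trDP => FE.
have F0 : 0 <= (12 + 8 * s2) * - tau.
  rewrite -FE; apply: addr_ge0; first by apply: sumr_ge0.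
  by apply: mulr_ge0; [exact: sqrtr_ge0|exact: addr_ge0].
have k0 : 0 < 12 + 8 * s2 by lra.
have t0 : 0 <= - tau by move: F0; rewrite pmulr_rge0.
rewrite sum4 in FE.
have := sum_sqr_le s22 (sqrtr_ge0 _) (sg i0) (sg i1) (sg i2) (sg i3) p0 p1
  (esym FE).
rewrite /gains_sq sum4 => /le_trans; apply.
move: tau_small; rewrite -normrN ger0_norm// => t1.
have k1 : (12 + 8 * s2) ^+ 2 <= 600 by nra.
have : (12 + 8 * s2) ^+ 2 * (- tau * - tau) <= 600 * (12 / 1000 * - tau).
  by rewrite ler_pM ?sqr_ge0 ?mulr_ge0// ler_wpM2r.
by rewrite exprMn expr2 -[\tr _]/tau; lra.
Qed.

(** If the width of none of the six functionals dropped below [2 + sqrt 2],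
    all six gains would be nonnegative. *)
Theorem short_functional X :
  (forall i, X i i = 0) -> (forall i, \sum_j X i j = 1) ->
  (forall i j, `|X i j - bary_pt i j| <= 1307 / 10 ^+ 5) -> X != bary_pt ->
  exists A (F : 'cV[R]_4), [/\ X *m F = char_col A,
    exists2 i, i \in A & exists j, j \notin A &
    forall j l, F j 0 - F l 0 < 2 + s2].
Proof.
move=> X0 X1 XP XnP; pose goal := exists A (F : 'cV[R]_4),
  [/\ X *m F = char_col A, exists2 i, i \in A & exists j, j \notin A &
    forall j l, F j 0 - F l 0 < 2 + s2].
rewrite -/goal; have [D [XG DX D0 Dl]] := perturbed_inverse X0 X1 XP.
have short A : (exists2 i, i \in A & exists j, j \notin A) -> (forall j l,
    vertex_values D A j 0 - vertex_values D A l 0 < 2 + s2) -> goal.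
  move=> A01 h; exists A, (vertex_values D A).
  by split; rewrite // mulmxA XG mul1mx.
have single i : goal \/ 0 <= single_gain (1 + s2) D i.
  have [h|] := width_dichotomy D0 Dl (single_gap i).
    left; apply: short h; exists i; rewrite ?inE//; exists (i + 1); rewrite inE.
    by move: i; apply: forall4; rewrite shift4.
  by rewrite (single_width _ D0) lerDl; right.
have pair i : i = i0 \/ i = i1 -> goal \/ 0 <= pair_gain (1 + s2) D i.
  move=> ii; have [h|] := width_dichotomy D0 Dl (fun j l => pair_gap j l ii).
    left; apply: short h; exists (i + 1); rewrite ?inE ?eqxx//.
    by exists i; rewrite !inE; case: ii => ->; rewrite !shift4.
  by rewrite (pair_width ii D0) lerDl; right.
have [//|g0] := single i0; have [//|g1] := single i1.
have [//|g2] := single i2; have [//|g3] := single i3.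
have [//|h0] := pair i0 (or_introl erefl).
have [//|h1] := pair i1 (or_intror erefl).
case/eqP: XnP; have D00 : D = 0.
  by apply: (gains_ge0_rigid X0 XP DX D0 Dl) => //; apply: forall4.
by apply/eqP; rewrite -subr_eq0 -DX D00 mul0mx.
Qed.

End tetrahedron_matrix.

Local Open Scope classical_set_scope.

(** * Lattice widths of polytopes *)

Section polytope.
Context {R : realType} {E : lmodType R}.

Lemma conv_hull_min (A B : set E) :
  (forall x y t, 0 <= t <= 1 -> B x -> B y -> B (t *: x + (1 - t) *: y)) ->
  A `<=` B -> conv_hull A `<=` B.
Proof.
move=> cB AB; apply: smallest_sub => // x y t; rewrite !inE => Bx By.
by apply: cB => //; apply/andP.
Qed.

Lemma conv_hull_affine n (a : 'I_n -> E) (S : set 'I_n) x :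
  conv_hull (a @` S) x -> exists l : 'I_n -> R,
    [/\ forall i, ~ S i -> l i = 0, \sum_i l i = 1 & x = \sum_i l i *: a i].
Proof.
apply: (@conv_hull_min _ [set x | exists l : 'I_n -> R,
    [/\ forall i, ~ S i -> l i = 0, \sum_i l i = 1 & x = \sum_i l i *: a i]]).
  move=> {}x y t _ [l [l0 l1 ->]] [m [m0 m1 ->]].
  exists (fun i => t * l i + (1 - t) * m i); split.
  - by move=> i Si; rewrite l0// m0// !mulr0 addr0.
  - by rewrite big_split/= -!mulr_sumr l1 m1 !mulr1 addrC subrK.
  - rewrite !scaler_sumr -big_split; apply: eq_bigr => i _ /=.
    by rewrite !scalerA scalerDl.
move=> _ [i Si <-]; exists (fun j => (j == i)%:R); split.
- by move=> j; case: eqP => [->|].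
- by rewrite (bigD1 i)//= eqxx big1 ?addr0// => j /negPf ->.
- rewrite (bigD1 i)//= eqxx scale1r big1 ?addr0// => j /negPf ->.
  by rewrite scale0r.
Qed.

Lemma aff_lattice_gen m (q : 'I_m -> E) i : aff_lattice q (q i).
Proof.
exists (fun j => (j == i)%:R); split.
  by rewrite (bigD1 i)//= eqxx big1 ?addr0// => j /negPf ->.
rewrite (bigD1 i)//= eqxx scale1r big1 ?addr0// => j /negPf ->.
by rewrite scale0r.
Qed.

Lemma dual_aff_lattice (f : {scalar E}) m (q : 'I_m.+1 -> E) :
  (forall i, f (q i) - f (q ord0) \is a Num.int) ->
  dual_lattice (aff_lattice q) f.
Proof.
move=> fq; have fL x : aff_lattice q x -> f x - f (q ord0) \is a Num.int.
  move=> [c [c1 ->]]; rewrite linear_sum.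
  have -> : f (q ord0) = \sum_i (c i)%:~R * f (q ord0).
    by rewrite -mulr_suml -[X in X * _](raddf_sum (intmul 1)) c1 mul1r.
  rewrite -sumrB rpred_sum// => i _.
  by rewrite linearZ /= -mulrBr rpredM// rpred_int.
move=> _ [x Lx [y Ly <-]]; rewrite linearB -[X in X \is a _](subrKA (f (q ord0))).
by rewrite rpredD ?fL// -opprB rpredN fL.
Qed.

Context {n : nat} (a : 'I_n.+1 -> E).
Let K := conv_hull (range a).

Lemma polytope_vertex i : K (a i).
Proof. by apply: sub_gen_smallest; exists i. Qed.

Lemma polytope_extrema (f : {scalar E}) : exists imin imax,
  forall x, K x -> f (a imin) <= f x <= f (a imax).
Proof.
have [imax _ himax] := @arg_maxP _ _ _ ord0 predT (fun i => f (a i)) isT.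
have [imin _ himin] := @arg_minP _ _ _ ord0 predT (fun i => f (a i)) isT.
exists imin, imax; apply: conv_hull_min => [x y t /andP[t0 t1] /=|]; last first.
  by move=> _ [i _ <-] /=; apply/andP; split; [exact: himin|exact: himax].
move=> /andP[lx hx] /andP[ly hy]; rewrite linearD !linearZ /=.
rewrite -subr_ge0 in t1; apply/andP; split.
  by have := ler_wpM2l t0 lx; have := ler_wpM2l t1 ly; lra.
by have := ler_wpM2l t0 hx; have := ler_wpM2l t1 hy; lra.
Qed.

Lemma width_polytope_lt (f : {scalar E}) c :
  (forall i j, f (a i) - f (a j) < c) -> width K f < c.
Proof.
move=> fc; have [imin [imax fK]] := polytope_extrema f.
apply: le_lt_trans (fc imax imin).
have ne : f @` K !=set0.
  by exists (f (a ord0)), (a ord0) => //; exact: polytope_vertex.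
apply: lerB; first by apply: ge_sup => // _ [x /fK/andP[_ ?] <-].
by apply: lb_le_inf => // _ [x /fK/andP[? _] <-].
Qed.

Lemma width_polytope_ge (f : {scalar E}) i j : f (a i) - f (a j) <= width K f.
Proof.
have [imin [imax fK]] := polytope_extrema f; apply: lerB.
  apply: ub_le_sup; last by exists (a i) => //; exact: polytope_vertex.
  by exists (f (a imax)) => _ [x /fK/andP[_ ?] <-].
apply: ge_inf; last by exists (a j) => //; exact: polytope_vertex.
by exists (f (a imin)) => _ [x /fK/andP[? _] <-].
Qed.

Lemma lattice_width_lt (L : set E) (f : {scalar E}) c :
  dual_lattice L f -> (exists x, f x != 0) ->
  (forall i j, f (a i) - f (a j) < c) -> lattice_width L K < c.
Proof.
move=> fL f0 fc; apply: le_lt_trans (width_polytope_lt fc).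
apply: ge_inf; last by exists f.
exists 0 => _ [g _ <-]; apply: le_trans (width_polytope_ge g ord0 ord0).
by rewrite subrr.
Qed.

(** The first hypothesis matters because [inf] of the empty set is 0. *)
Lemma lattice_width_ge (L : set E) c :
  (exists2 f : {scalar E}, dual_lattice L f & exists x, f x != 0) ->
  (forall f : {scalar E}, dual_lattice L f -> (exists x, f x != 0) ->
     exists i j, c <= f (a i) - f (a j)) ->
  c <= lattice_width L K.
Proof.
move=> [f fL f0] h; apply: lb_le_inf; first by exists (width K f), f.
move=> _ [g [gL g0] <-]; have [i [j cij]] := h g gL g0.
exact: le_trans (width_polytope_ge g i j).
Qed.

End polytope.

(** * Functionals and barycentric coordinates on the tetrahedron *)

Section tetrahedron_geometry.
Context {R : realType}.
Local Notation s2 := (Num.sqrt 2 : R).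
Local Notation V := 'rV[R]_3.

(** The vertices are affinely independent.  In this form the fact also yields
    the barycentric coordinates, as the functionals that interpolate the
    indicator of a vertex. *)
Lemma affine_interp (F : 'I_4 -> R) :
  exists (f : {scalar V}) c, forall j, f (vert j) + c = F j.
Proof.
have s22 := @sqr_s2 R; have /andP[s1 s3] := @s2_bounds R.
(* The differences [vert 0 - vert 2] and [vert 1 - vert 3] span the horizontal
   plane and determine the first two coefficients by Cramer's rule;
   [vert 0 + vert 2 - vert 1 - vert 3] is vertical. *)
pose u : 'cV[R]_3 := \col_j [::
  ((4 + 2 * s2) * (F i0 - F i2) - 2 * s2 * (F i1 - F i3)) / (32 + 16 * s2);
  ((4 + 2 * s2) * (F i1 - F i3) + 2 * s2 * (F i0 - F i2)) / (32 + 16 * s2);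
  (F i0 + F i2 - F i1 - F i3) / (8 + 4 * s2)]`_j.
pose f' (v : V) : R^o := (v *m u) 0 0.
have flin : scalar f' by move=> a x y; rewrite /f' mulmxDl -scalemxAl !mxE.
pose fm := GRing.isLinear.Build R V R^o *%R f' flin.
pose f : {scalar V} := HB.pack f' fm.
exists f, ((F i0 + F i1 + F i2 + F i3) / 4).
have n1 : 32 + 16 * s2 != 0 by lra.
have n2 : 8 + 4 * s2 != 0 by lra.
have fE v : f v = v 0 0 * u 0 0 + v 0 1 * u 1 0 + v 0 2 * u 2 0.
  rewrite /f /= /f' mxE !big_ord_recl big_ord0 addr0 !addrA.
  by do !congr (_ + _); congr (_ * _); congr (_ _ _); apply: val_inj.
by apply: forall4; rewrite fE !mxE /=; field: s22; rewrite n1 n2.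
Qed.

Lemma bary_comb (l : 'I_4 -> R) : \sum_i l i = 1 ->
  bary vert (\sum_i l i *: vert i) = \row_i l i.
Proof.
move=> l1; apply: xget_unique.
  by split; [rewrite -[RHS]l1|]; apply: eq_bigr => i _; rewrite mxE.
move=> m [m1 mE]; apply/rowP => i; rewrite mxE.
have [f [c fc]] := @affine_interp (fun j => (j == i)%:R).
have coord (w : 'I_4 -> R) : \sum_j w j = 1 ->
    f (\sum_j w j *: vert j) + c = w i.
  move=> w1; rewrite linear_sum -[c]mul1r -w1 mulr_suml -big_split /=.
  rewrite (bigD1 i)//= linearZ /= -mulrDr fc eqxx mulr1 big1 ?addr0// => j ji.
  by rewrite linearZ /= -mulrDr fc (negPf ji) mulr0.
by rewrite -(coord l l1) -mE (coord (fun j => m 0 j)).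
Qed.

Lemma ptE i : pt i = \sum_j @bary_pt R i j *: vert j.
Proof.
have s22 := @sqr_s2 R.
apply/rowP => k; rewrite summxE sum4 !mxE; case: k => [[|[|[|//]]] ltk];
  move: i; apply: forall4; rewrite !mxE /=; by field: s22.
Qed.

Lemma dist_Delta_coord (l m : 'I_4 -> R) i :
  \sum_i l i = 1 -> \sum_i m i = 1 ->
  `|m i - l i| <= dist_Delta (\sum_i l i *: vert i) (\sum_i m i *: vert i).
Proof.
move=> l1 m1; rewrite /dist_Delta !bary_comb// distrC.
have -> : l i - m i = (\row_i l i - \row_i m i) 0 i by rewrite !mxE.
rewrite [leRHS]/Num.norm /= mx_normrE.
by apply/bigmax_geP; right; exists (0, i).
Qed.

(** A solution [F] of [X F = N] is the vector of vertex values of a functional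
    with values [N] at the points [q i], up to a common constant; so the
    functional is integral on the lattice spanned by the [q i]. *)
Lemma dual_of_char_col (X : 'M[R]_4) (q : 'I_4 -> V) A (F : 'cV[R]_4) :
  (forall i, q i = \sum_j X i j *: vert j) -> (forall i, \sum_j X i j = 1) ->
  X *m F = char_col A -> (exists2 i, i \in A & exists j, j \notin A) ->
  exists f : {scalar V}, [/\ dual_lattice (aff_lattice q) f,
    exists x, f x != 0 & forall i j, f (vert i) - f (vert j) = F i 0 - F j 0].
Proof.
move=> qE X1 XF [i iA [j jA]].
have [f [c fc]] := affine_interp (fun j => F j 0).
have fq k : f (q k) + c = (k \in A)%:R.
  have -> : (k \in A)%:R = (X *m F) k 0 by rewrite XF mxE.
  rewrite qE linear_sum -[c]mul1r -(X1 k) mulr_suml -big_split mxE /=.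
  by apply: eq_bigr => m _; rewrite linearZ /= -mulrDr fc.
have fqB k m : f (q k) - f (q m) = (k \in A)%:R - (m \in A)%:R.
  by rewrite -!fq opprD addrACA subrr addr0.
exists f; split.
- by apply: dual_aff_lattice => k; rewrite fqB rpredB// natr_int.
- by exists (q i - q j); rewrite linearB fqB iA (negPf jA) subr0 oner_neq0.
- by move=> k m; rewrite -!fc opprD addrACA subrr addr0.
Qed.

(** * The width with respect to the unperturbed lattice *)

Lemma scalar_coord (f : {scalar V}) (v : V) :
  f v = v 0 0 * f (vec3 1 0 0) + v 0 1 * f (vec3 0 1 0) + v 0 2 * f (vec3 0 0 1).
Proof.
have {1}-> :
    v = v 0 0 *: vec3 1 0 0 + v 0 1 *: vec3 0 1 0 + v 0 2 *: vec3 0 0 1.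
  apply/rowP => -[[|[|[|//]]] ltk];
    rewrite !mxE /= ?(mulr0, mulr1, addr0, add0r);
    by congr (v 0 _); apply: val_inj.
by rewrite !linearD !linearZ.
Qed.

(** [a], [b], [c] have the same parity: if even, a nonzero one is at least 2
    in absolute value; if odd, all three are nonzero.  The four regions for
    [(a, b)] are quadrants rotated into each other by the fourfold symmetry of
    [Delta]. *)
Lemma parity_cases (a b c m n p : int) :
  a = m + n - p -> b = n + p - m -> c = m + p - n ->
  ~ (a = 0 /\ b = 0 /\ c = 0) ->
  (2 <= c \/ c <= -2) \/
  ((2 <= a /\ 0 <= b \/ a <= -2 /\ b <= 0) \/
   (a <= 0 /\ 2 <= b \/ 0 <= a /\ b <= -2)) \/
  ((1 <= a \/ a <= -1) /\ (1 <= b \/ b <= -1) /\ (1 <= c \/ c <= -1)).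
Proof. lia. Qed.

Lemma Lambda_width_ge : 2 + s2 <= lattice_width (@Lambda R) Delta.
Proof.
have /andP[s1 s3] := @s2_bounds R.
apply: lattice_width_ge.
  have PF : @bary_pt R *m (inv_bary_pt *m char_col [set i0]%SET) =
      char_col [set i0]%SET by rewrite mulmxA mul_bary_pt_inv mul1mx.
  have [|f [fL f0 _]] := dual_of_char_col ptE (@bary_pt_row_sum R) PF.
    by exists i0; rewrite ?inE//; exists i1; rewrite inE.
  by exists f => //; rewrite Lambda_spanned.
move=> f; rewrite Lambda_spanned => fL [x fx].
have fint i j : exists m : int, f (pt i) - f (pt j) = m%:~R.
  apply/intrP; rewrite -linearB; apply: fL.
  exists (pt i); first exact: aff_lattice_gen.
  by exists (pt j) => //; exact: aff_lattice_gen.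
have [m mE] := fint i1 i0; have [n nE] := fint i2 i0; have [p pE] := fint i3 i0.
have ptf i : f (pt i) = _ := scalar_coord f (pt i).
have vf i : f (vert i) = _ := scalar_coord f (vert i).
rewrite scalar_coord in fx; rewrite !ptf !mxE /= in mE nE pE.
set u := f (vec3 1 0 0) in fx mE nE pE vf.
set v := f (vec3 0 1 0) in fx mE nE pE vf.
set w := f (vec3 0 0 1) in fx mE nE pE vf.
pose a := m + n - p; pose b := n + p - m; pose c := m + p - n.
have ua : u = a%:~R / 4 by rewrite !rmorphD rmorphN /=; lra.
have vb : v = b%:~R / 4 by rewrite !rmorphD rmorphN /=; lra.
have wc : w = c%:~R / 4 by rewrite !rmorphD rmorphN /=; lra.
have nz : ~ (a = 0 /\ b = 0 /\ c = 0).
  move=> [a0 [b0 c0]]; move/eqP: fx.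
  by rewrite ua vb wc a0 b0 c0 !mul0r !mulr0 !addr0.
have s0 : 0 <= s2 by exact: sqrtr_ge0.
have up k (z : int) : k <= z ->
    (k%:~R <= z%:~R :> R) * (s2 * k%:~R <= s2 * z%:~R).
  by move=> kz; split; rewrite ?ler_wpM2l// ler_int.
have dn k (z : int) : z <= k ->
    (z%:~R <= k%:~R :> R) * (s2 * z%:~R <= s2 * k%:~R).
  by move=> kz; split; rewrite ?ler_wpM2l// ler_int.
have pick i j : 2 + s2 <= (vert i 0 0 - vert j 0 0) * u
    + (vert i 0 1 - vert j 0 1) * v + (vert i 0 2 - vert j 0 2) * w ->
    exists i j, 2 + s2 <= f (vert i) - f (vert j).
  by move=> h; exists i, j; rewrite !vf -/u -/v -/w; lra.
have := parity_cases (erefl a) (erefl b) (erefl c) nz.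
rewrite ua vb wc in pick.
move: pick up dn; clear; move: a b c => a b c pick up dn.
case=> [hc|[[ha|hb]|[ha [hb hc]]]].
- (* The horizontal parts of [vert 0 - vert 1] and [vert 2 - vert 3] are
     opposite, so one of them helps. *)
  have [t|t] := lerP 0 ((1 + s2) * a%:~R - b%:~R).
    by case: hc => [/up[? ?]|/dn[? ?]];
      [apply: (pick i0 i1)|apply: (pick i3 i2)]; rewrite !mxE /=; lra.
  by case: hc => [/up[? ?]|/dn[? ?]];
    [apply: (pick i2 i3)|apply: (pick i1 i0)]; rewrite !mxE /=; lra.
- by case: ha => -[]; [move=> /up[? ?] /up[? ?]; apply: (pick i0 i2)
    |move=> /dn[? ?] /dn[? ?]; apply: (pick i2 i0)]; rewrite !mxE /=; lra.
- by case: hb => -[]; [move=> /dn[? ?] /up[? ?]; apply: (pick i1 i3)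
    |move=> /up[? ?] /dn[? ?]; apply: (pick i3 i1)]; rewrite !mxE /=; lra.
case: ha => [/up[? ?]|/dn[? ?]]; case: hb => [/up[? ?]|/dn[? ?]];
  case: hc => [/up[? ?]|/dn[? ?]].
- by apply: (pick i0 i3); rewrite !mxE /=; lra.
- by apply: (pick i1 i2); rewrite !mxE /=; lra.
- by apply: (pick i0 i1); rewrite !mxE /=; lra.
- by apply: (pick i3 i2); rewrite !mxE /=; lra.
- by apply: (pick i2 i3); rewrite !mxE /=; lra.
- by apply: (pick i1 i0); rewrite !mxE /=; lra.
- by apply: (pick i2 i1); rewrite !mxE /=; lra.
- by apply: (pick i3 i0); rewrite !mxE /=; lra.
Qed.

End tetrahedron_geometry.

Unset Implicit Arguments.

(** * The perturbed lattices *)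

Theorem theorem1p4 (R : realType) (p' : 'I_4 -> 'rV[R]_3)
    (p'_facet : forall i, facet i (p' i))
    (p'_close : forall i, dist_Delta (pt i) (p' i) <= 1307 / 10 ^+ 5) :
  lattice_width (aff_lattice p') Delta <= lattice_width Lambda Delta /\
  (lattice_width (aff_lattice p') Delta = lattice_width Lambda Delta <->
   forall i, p' i = pt i).
Proof.
have /choice[l lP] : forall i, exists l : 'I_4 -> R,
    [/\ l i = 0, \sum_j l j = 1 & p' i = \sum_j l j *: vert j].
  move=> i; have [l [l0 l1 lE]] := conv_hull_affine (p'_facet i).
  by exists l; split=> //; apply: l0; rewrite /= eqxx.
pose X : 'M[R]_4 := \matrix_(i, j) l i j.
have X0 i : X i i = 0 by rewrite mxE; case: (lP i).
have X1 i : \sum_j X i j = 1.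
  by have [_ <- _] := lP i; apply: eq_bigr => j _; rewrite mxE.
have p'E i : p' i = \sum_j X i j *: vert j.
  by have [_ _ ->] := lP i; apply: eq_bigr => j _; rewrite mxE.
have XP i j : `|X i j - bary_pt i j| <= 1307 / 10 ^+ 5.
  apply: le_trans (p'_close i); rewrite ptE p'E.
  by apply: dist_Delta_coord; rewrite // bary_pt_row_sum.
have [XE|XnP] := eqVneq X bary_pt.
  have -> : p' = pt by apply/funext => i; rewrite p'E XE ptE.
  by rewrite Lambda_spanned; split.
have [A [F [XF A01 FB]]] := short_functional X0 X1 XP XnP.
have [f [fL f0 fF]] := dual_of_char_col p'E X1 XF A01.
have lt : lattice_width (aff_lattice p') Delta < lattice_width (@Lambda R) Delta.
  apply: lt_le_trans Lambda_width_ge; apply: lattice_width_lt fL f0 _ => i j.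
  by rewrite fF.
split; first exact: ltW.
split=> [e|pp]; first by rewrite e ltxx in lt.
rewrite Lambda_spanned; congr (lattice_width (aff_lattice _) _).
exact/funext.
Qed.
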